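(* Let $G=(V,E)$ be a finite simple connected undirected graph with $V=\{1,2,\dots,n\}$, let $d$ be its distance function and, for $v\in V$, let $\mathcal{N}(v)$ be the set of vertices adjacent to $v$. Consider the following two integer linear programs in the variables $x_1,\dots,x_n$. Program (A): minimize $\sum_{i=1}^n x_i$ subject to - $x_i+\sum_{j\in\mathcal{N}(i)}x_j\ge 1$ for all $1\le i\le n$; - $x_k-x_i-x_j\ge -1$ for all $1\le i<j\le n$ and all $k\in V$ such that $d(i,k)+d(k,j)=d(i,j)$; - $x_i\in\{0,1\}$ for all $1\le i\le n$. Program (B): minimize $\sum_{i=1}^n x_i$ subject to - $x_i+\sum_{j\in\mathcal{N}(i)}x_j\ge 1$ for all $1\le i\le n$; - $x_k-x_i-x_j\ge -1$ for all $1\le i<j\le n$ and all $k\in\mathcal{N}(i)\cup\mathcal{N}(j)$ such that $d(i,k)+d(k,j)=d(i,j)$; - $x_i\in\{0,1\}$ for all $1\le i\le n$. Then the optimal solution value of Program (A) is equal to the optimal solution value of Program (B).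
   Context: Graphs are without loops and parallel edges. For vertices $u,v$ of a connected graph $G$, $d(u,v)$ denotes the length (number of edges) of a shortest $u$-$v$ path in $G$. $\mathcal{N}(v)$ is the open neighbourhood of $v$ (the set of all vertices adjacent to $v$, not containing $v$). *)

(* Defs.v *)
(* MathComp world.  A graph on {1, ..., n} is a relation e : rel 'I_n, the
   vertex i being represented by the ordinal of value i - 1; simplicity is
   expressed by irreflexivity and symmetry of e. *)
From mathcomp Require Import all_boot all_order all_algebra.

Set Implicit Arguments.
Unset Strict Implicit.
Unset Printing Implicit Defensive.

Import Order.TTheory GRing.Theory Num.Theory.
Local Open Scope ring_scope.

Definition connected_graph (T : finType) (e : rel T) : Prop :=
  forall u v : T, connect e u v.

Definition nbhd (T : finType) (e : rel T) (v : T) : {set T} := [set w | e v w].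

(* [u :: p] lists the vertices of the path, which are pairwise distinct, so
   that [size p] is its number of edges. *)
Definition is_path (T : finType) (e : rel T) (u v : T) (p : seq T) : bool :=
  [&& path e u p, last u p == v & uniq (u :: p)].

(* A path has fewer than #|T| edges, so the minimum below ranges over all the
   lengths of u-v paths; the default #|T| is only returned if there are none. *)
Definition dist (T : finType) (e : rel T) (u v : T) : nat :=
  \big[minn/#|T|]_(m < #|T| | [exists p : m.-tuple T, is_path e u v p]) m.

Lemma dist_path_min (T : finType) (e : rel T) (u v : T) (p : seq T) :
  is_path e u v p -> (dist e u v <= size p)%N.
Proof.
move=> pP; have /and3P[_ _ up] := pP.
have lt_p : (size p < #|T|)%N.
  by rewrite -[(size p).+1]/(size (u :: p)) -(card_uniqP up) max_card.
have exP : [exists q : (size p).-tuple T, is_path e u v q].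
  by apply/existsP; exists (in_tuple p).
rewrite /dist; have := mem_index_enum (Ordinal lt_p).
elim: (index_enum _) => [//|m r IH]; rewrite inE big_cons.
case/predU1P=> [<-|/IH {}IH]; first by rewrite exP geq_minl.
by case: ifP => // _; rewrite geq_min IH orbT.
Qed.

Lemma dist_path_ex (T : finType) (e : rel T) (u v : T) :
  connect e u v -> exists2 p, is_path e u v p & size p = dist e u v.
Proof.
case/connectP=> p0 /shortenP[p pp up _ ->].
have pP : is_path e u (last u p) p by rewrite /is_path pp eqxx.
have lt_d : (dist e u (last u p) < #|T|)%N.
  apply: leq_ltn_trans (dist_path_min pP) _.
  by rewrite -[(size p).+1]/(size (u :: p)) -(card_uniqP up) max_card.
move: lt_d; rewrite /dist.
elim/big_ind: _ => [|a b IHa IHb|m /existsP[q qP] _]; first by rewrite ltnn.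
  by rewrite /minn; case: ifP.
by exists q => //; rewrite size_tuple.
Qed.

Definition objective (n : nat) (x : {ffun 'I_n -> int}) : int := \sum_i x i.

Definition domination_constraints (n : nat) (e : rel 'I_n)
    (x : {ffun 'I_n -> int}) : Prop :=
  forall i : 'I_n, x i + \sum_(j in nbhd e i) x j >= 1.

Definition binary_constraints (n : nat) (x : {ffun 'I_n -> int}) : Prop :=
  forall i : 'I_n, x i = 0 \/ x i = 1.

Definition feasibleA (n : nat) (e : rel 'I_n) (x : {ffun 'I_n -> int}) : Prop :=
  [/\ domination_constraints e x,
      forall i j k : 'I_n, (i < j)%N ->
        (dist e i k + dist e k j)%N = dist e i j ->
        x k - x i - x j >= -1
    & binary_constraints x].

Definition feasibleB (n : nat) (e : rel 'I_n) (x : {ffun 'I_n -> int}) : Prop :=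
  [/\ domination_constraints e x,
      forall i j k : 'I_n, (i < j)%N ->
        k \in nbhd e i :|: nbhd e j ->
        (dist e i k + dist e k j)%N = dist e i j ->
        x k - x i - x j >= -1
    & binary_constraints x].

(* [z] is the (attained) minimum of the objective over the feasible points. *)
Definition optimal_value (n : nat) (feasible : {ffun 'I_n -> int} -> Prop)
    (z : int) : Prop :=
  (exists2 x, feasible x & objective x = z) /\
  (forall x, feasible x -> z <= objective x).

(* Main.v *)
Require Import Defs.
From mathcomp Require Import all_boot all_order all_algebra.
From mathcomp Require Import zify.
From Stdlib Require Import Classical.

(** The two programs have the same feasible points. On binary points the
    betweenness constraints of (A) say that the set [x = 1] is geodesically
    convex, those of (B) only that the first step from [i] (or [j]) on any
    [i]-[j] geodesic stays in it. Walking from [i] towards [k], one such step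
    [w] at a time, replaces the pair [(i, j)] by the closer pair [(w, j)], with
    [k] still between them. *)

Set Implicit Arguments.
Unset Strict Implicit.
Unset Printing Implicit Defensive.

Import Order.TTheory GRing.Theory Num.Theory.
Local Open Scope ring_scope.

Section Distance.

Variables (T : finType) (e : rel T).

(** A walk may repeat vertices; shortening it to a path only drops some of them, so its length still
    bounds the distance. *)
Lemma dist_walk (u : T) (p : seq T) :
  path e u p -> (dist e u (last u p) <= size p)%N.
Proof.
case/shortenP=> q eq_q /[dup] uq /andP[_ q_uniq] /(uniq_leq_size q_uniq).
by apply/leq_trans/dist_path_min; rewrite /is_path eq_q eqxx.
Qed.

Lemma dist_refl (u : T) : dist e u u = 0%N.
Proof. by apply/eqP; rewrite -leqn0; apply: (@dist_walk u [::]). Qed.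

Lemma dist_edge (u v : T) : e u v -> (dist e u v <= 1)%N.
Proof. by move=> uv; apply: (@dist_walk u [:: v]); rewrite /= uv. Qed.

Hypothesis e_conn : connected_graph e.

Lemma dist_triangle (u v w : T) : (dist e u w <= dist e u v + dist e v w)%N.
Proof.
have [p /and3P[pp /eqP pv _] <-] := dist_path_ex (e_conn u v).
have [q /and3P[qp /eqP qw _] <-] := dist_path_ex (e_conn v w).
by rewrite -size_cat -qw -pv -last_cat dist_walk // cat_path pp pv.
Qed.

Lemma dist_step (u v : T) :
  u != v -> exists2 w, e u w & (dist e w v < dist e u v)%N.
Proof.
have [[|w p] /and3P[/= pp /eqP pv _] <-] := dist_path_ex (e_conn u v).
  by rewrite pv eqxx.
case/andP: pp => uw pp _; exists w => //.
by rewrite ltnS -pv dist_walk.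
Qed.

Hypothesis e_sym : symmetric e.

Lemma dist_sym (u v : T) : dist e u v = dist e v u.
Proof.
suff le_dist a b : (dist e b a <= dist e a b)%N by apply/eqP; rewrite eqn_leq !le_dist.
have [p /and3P[pp /eqP <- _] <-] := dist_path_ex (e_conn a b).
(* A shortest path traversed backwards is a walk from [b] to [a]. *)
have last_rev : last (last a p) (rev (belast a p)) = a.
  by case: p {pp} => //= c p; rewrite rev_cons last_rcons.
rewrite -{2}last_rev -(size_belast a p) -size_rev dist_walk // rev_path.
by rewrite (eq_path (e' := e)) // => x y; rewrite e_sym.
Qed.

End Distance.

(** On 0/1 values the inequality fails only for [x i = x j = 1] and [x k = 0]. *)
Lemma binary_convexE (n : nat) (x : {ffun 'I_n -> int}) (i j k : 'I_n) :
  binary_constraints x ->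
  (-1 <= x k - x i - x j) <-> (x i = 1 -> x j = 1 -> x k = 1).
Proof. by move=> xb; case: (xb i) (xb j) (xb k) => -> [] -> [] ->; lia. Qed.

Lemma feasibleB_convex (n : nat) (e : rel 'I_n) (x : {ffun 'I_n -> int})
    (i j k : 'I_n) :
  symmetric e -> connected_graph e -> feasibleB e x ->
  (dist e i k + dist e k j)%N = dist e i j -> x i = 1 -> x j = 1 -> x k = 1.
Proof.
move=> e_sym e_conn [_ xB xb].
(* The constraints of (B) are indexed by [i < j]; symmetry of the distance frees the step from the
   order of [a] and [b]. *)
have step a b c : e a c -> a != b ->
    (dist e a c + dist e c b)%N = dist e a b -> x a = 1 -> x b = 1 -> x c = 1.
  move=> ac ab d_acb xa1 xb1; case: (ltngtP a b) => [lt_ab|lt_ba|/val_inj eq_ab].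
  - by apply: (binary_convexE a b c xb).1 => //; apply: xB; rewrite ?inE ?ac.
  - apply: (binary_convexE b a c xb).1 => //; apply: xB; rewrite ?inE ?ac ?orbT //.
    by rewrite addnC !(dist_sym e_conn e_sym _ a) (dist_sym e_conn e_sym b).
  - by rewrite eq_ab eqxx in ab.
have [m] := ubnP (dist e i j); elim: m i => // m IH i lt_m d_ikj xi1 xj1.
have [<- //|/(dist_step e_conn)[w iw lt_w]] := eqVneq i k.
have d_iw := dist_edge iw.
have tri_iwj := dist_triangle e_conn i w j.
have tri_wkj := dist_triangle e_conn w k j.
(* If [i = j], then [dist e i k = 0], contradicting [lt_w]. *)
have ij : i != j by apply/eqP=> eq_ij; move: d_ikj; rewrite -eq_ij dist_refl; lia.
(* The triangle inequalities are tight: [w] lies between [i] and [j], [k] between [w] and [j], and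
   [w] is one closer to [j] than [i] is. *)
have xw1 : x w = 1 by apply: (step i j) => //; lia.
by apply: (IH w) => //; lia.
Qed.

Lemma feasibleAB (n : nat) (e : rel 'I_n) (x : {ffun 'I_n -> int}) :
  symmetric e -> connected_graph e -> feasibleA e x <-> feasibleB e x.
Proof.
move=> e_sym e_conn; split=> [[xd xA xb]|/[dup] xB [xd _ xb]]; split=> // i j k.
  by move=> lt_ij _; apply: xA.
move=> _ d_ikj; apply/(binary_convexE _ _ _ xb).
exact: feasibleB_convex xB d_ikj.
Qed.

Lemma feasibleA1 (n : nat) (e : rel 'I_n) : feasibleA e [ffun=> 1].
Proof.
split=> [i|i j k _ _|i]; rewrite ?ffunE //; last by right.
by rewrite lerDl sumr_ge0 // => j _; rewrite ffunE.
Qed.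

(** Objectives of binary points are nonnegative integers, so passing to ever better points must
    stop. *)
Lemma optimal_value_ex (n : nat) (F : {ffun 'I_n -> int} -> Prop) :
  (forall x, F x -> binary_constraints x) -> (exists x, F x) ->
  exists z, optimal_value F z.
Proof.
move=> Fb [x Fx]; have [m] := ubnP `|objective x|%N.
elim: m x Fx => // m IH x Fx lt_m.
have obj_ge0 y : F y -> 0 <= objective y.
  by move=> /Fb yb; apply: sumr_ge0 => i _; case: (yb i) => ->.
(* [F] is an arbitrary proposition, hence the classical case split. *)
have [[y Fy lt_yx]|x_min] := classic (exists2 y, F y & objective y < objective x).
  by apply: (IH y Fy); have := obj_ge0 _ Fy; lia.
exists (objective x); split=> [|y Fy]; first by exists x.
by rewrite leNgt; apply/negP=> lt_yx; apply: x_min; exists y.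
Qed.

Theorem theorem1 (n : nat) (e : rel 'I_n)
    (e_irr : irreflexive e) (e_sym : symmetric e)
    (e_conn : connected_graph e) :
  exists z : int,
    optimal_value (feasibleA e) z /\ optimal_value (feasibleB e) z.
Proof.
have [||z zA] := @optimal_value_ex n (feasibleA e).
- by move=> x [].
- by exists [ffun=> 1]; apply: feasibleA1.
exists z; split=> //; case: zA => [[x xA xz] z_min]; split.
  by exists x => //; apply/feasibleAB.
by move=> y yB; apply/z_min/feasibleAB.
Qed.
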